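(* Let $k\ge3$. The number of minimal $(k,3)$-bicrucial permutations is $$\frac{(1+\delta_{k,3})(k+1)(k-2)}{2},$$ where $\delta_{k,3}$ is the Kronecker delta. In particular, for $k=4,5,6,7,8,9$ these numbers are $5,9,14,20,27,35$.
   Context: $i_m=12\cdots m$ and $d_m=m(m-1)\cdots 1$; a permutation (in one-line notation) contains $i_m$ (resp. $d_m$) if it has an increasing (resp. decreasing) subsequence of length $m$, and avoids it otherwise. For $1\le t\le n+1$ put $e_t(x)=x$ if $x<t$ and $e_t(x)=x+1$ if $x\ge t$. The extensions of a permutation $\sigma=\sigma_1\cdots\sigma_n$ of $\{1,\ldots,n\}$ ($n\ge1$) to the right are $e_t(\sigma_1)\cdots e_t(\sigma_n)\,t$, and to the left are $t\,e_t(\sigma_1)\cdots e_t(\sigma_n)$, for $1\le t\le n+1$. A permutation is $(k,\ell)$-bicrucial if it avoids $i_k$ and $d_\ell$ but each of its extensions to the right and each of its extensions to the left contains $i_k$ or $d_\ell$. Such a permutation is minimal if there is no $(k,\ell)$-bicrucial permutation (same $k,\ell$) of smaller length. *)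

(* Defs.v *)
From mathcomp Require Import all_boot all_fingroup.
From mathcomp Require Import classical_sets cardinality.

Set Implicit Arguments.
Unset Strict Implicit.
Unset Printing Implicit Defensive.

(* A permutation of length n is an element s of 'S_n; positions and values are
   numbered from 0, so that its one-line notation is s 0, ..., s (n - 1).
   A subsequence is given by its set A of positions. *)

Definition contains_inc (m n : nat) (s : 'S_n) : bool :=
  [exists A : {set 'I_n}, (#|A| == m) &&
     [forall i in A, forall j in A, (i < j) ==> (s i < s j)]].

Definition contains_dec (m n : nat) (s : 'S_n) : bool :=
  [exists A : {set 'I_n}, (#|A| == m) &&
     [forall i in A, forall j in A, (i < j) ==> (s j < s i)]].

(* [lift t x] is x if x < t and x + 1 if t <= x. Hence [lift_perm ord_max t s]
   relabels the entries of s by [lift t] and appends the new entry t, whereas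
   [lift_perm ord0 t s] prepends it. *)
Definition ext_right (n : nat) (s : 'S_n) (t : 'I_n.+1) : 'S_n.+1 :=
  lift_perm ord_max t s.

Definition ext_left (n : nat) (s : 'S_n) (t : 'I_n.+1) : 'S_n.+1 :=
  lift_perm ord0 t s.

Definition contains_inc_or_dec (k l n : nat) (s : 'S_n) : bool :=
  contains_inc k s || contains_dec l s.

Definition bicrucial (k l n : nat) (s : 'S_n) : bool :=
  [&& 0 < n,
      ~~ contains_inc_or_dec k l s,
      [forall t, contains_inc_or_dec k l (ext_right s t)] &
      [forall t, contains_inc_or_dec k l (ext_left s t)]].

Definition minimal_bicrucial (k l n : nat) (s : 'S_n) : Prop :=
  bicrucial k l s /\ forall (m : nat) (u : 'S_m), m < n -> ~~ bicrucial k l u.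

(* Permutations of all lengths together: a pair of a length and an element of
   the corresponding symmetric group. *)
Definition minimal_bicrucial_set (k l : nat) : set {n : nat & 'S_n} :=
  [set p | minimal_bicrucial k l (tagged p)]%classic.

(* Main.v *)
Require Import Defs.
From mathcomp Require Import all_boot all_fingroup zify.
From mathcomp Require Import classical_sets cardinality functions boolp.

Set Implicit Arguments.
Unset Strict Implicit.
Unset Printing Implicit Defensive.

(** Let s avoid i_k and d_3. Appending t creates i_k when some increasing
    subsequence of length k - 1 lies in the values below t, and creates d_3 when
    some inversion has both its values at or above t. The first condition is
    monotone in t and the second antitone, so they cover all t exactly when they
    overlap at a crossing point: some increasing subsequence of length k - 1 has
    all its values at most both values of some inversion. Prepending gives the
    mirror condition, with the values at least those of an inversion. This
    criterion is [bicrucialE].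

    The larger value of the first inversion exceeds the k - 1 values below it,
    so the length is at least k; in length k the values 0, ..., k - 2 would be in
    increasing order, yet the second inversion would be (1, 0)
    ([bicrucial_length]). In length k + 1 (values 0, ..., k) the counting is
    nearly tight, and forces the inversions to be (k, k - 1) and (1, 0) and the
    values 1, ..., k - 1 to appear in increasing order ([ends_swapped],
    [bicrucial_shape]). The only escape occurs for k = 3, where
    complementation preserves bicruciality: there the complement of s may have
    this form instead, but never both s and its complement.

    A permutation of this form is the word 1 2 ... k - 1 with k and 0 inserted.
    Put k after q of the k - 1 letters, and then 0 at position p. The two
    prescribed inversions and the avoidance of d_3 amount to 1 <= q <= k - 2 and
    1 <= p <= q + 1 ([ends_swapped_sandwich]), and the sum of q + 1 over these q
    is (k + 1)(k - 2) / 2. All these permutations are bicrucial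
    ([ends_swapped_bicrucial]), so the minimal length is k + 1 and the count is
    the one claimed, doubled when k = 3. *)

(** * Monotone subsequences of one-point extensions *)

(** The boolean b selects the direction: increasing for [true], decreasing for
    [false], so that both patterns share one theory. *)
Definition mono (b : bool) n (s : 'S_n) (A : {set 'I_n}) : bool :=
  [forall i in A, forall j in A, (i < j) ==> ((s i < s j) == b)].

Definition contains b m n (s : 'S_n) : bool :=
  [exists A : {set 'I_n}, (#|A| == m) && mono b s A].

Lemma monoP b n (s : 'S_n) (A : {set 'I_n}) :
  reflect {in A &, forall i j : 'I_n, i < j -> (s i < s j) = b} (mono b s A).
Proof.
apply: (iffP forall_inP) => [H i j iA jA lij | H i iA].
  by have /forall_inP/(_ j jA)/implyP/(_ lij)/eqP := H i iA.
by apply/forall_inP => j jA; apply/implyP => lij; apply/eqP/H.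
Qed.

Lemma perm_val_neq n (s : 'S_n) (i j : 'I_n) : i != j :> nat -> s i != s j :> nat.
Proof. by apply: contraNneq => /val_inj/perm_inj ->. Qed.

Lemma contains_incE m n (s : 'S_n) : contains_inc m s = contains true m s.
Proof.
apply: eq_existsb => A; congr (_ && _).
by do 2![apply: eq_forallb_in => ? _]; rewrite eqb_id.
Qed.

Lemma contains_decE m n (s : 'S_n) : contains_dec m s = contains false m s.
Proof.
apply: eq_existsb => A; congr (_ && _).
apply: eq_forallb_in => i _; apply: eq_forallb_in => j _.
case: ltnP => //= lij.
have : s i != s j :> nat by rewrite perm_val_neq // ltn_eqF.
by case: ltngtP.
Qed.

Lemma contains_inc_or_decE k l n (s : 'S_n) :
  contains_inc_or_dec k l s = contains true k s || contains false l s.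
Proof. by rewrite -contains_incE -contains_decE. Qed.

Lemma ltn_lift2 n (h : 'I_n.+1) (i j : 'I_n) : (lift h i < lift h j) = (i < j).
Proof. rewrite /= /bump; lia. Qed.

Lemma ltn_liftl n (h : 'I_n.+1) (i : 'I_n) : (lift h i < h) = (i < h).
Proof. rewrite /= /bump; lia. Qed.

Lemma ltn_liftr n (h : 'I_n.+1) (i : 'I_n) : (h < lift h i) = ~~ (i < h).
Proof. rewrite /= /bump; lia. Qed.

Definition restr n (h : 'I_n.+1) (A : {set 'I_n.+1}) : {set 'I_n} :=
  [set j | lift h j \in A].

Lemma card_restr n (h : 'I_n.+1) (A : {set 'I_n.+1}) :
  #|A| = (h \in A) + #|restr h A|.
Proof.
rewrite (cardsD1 h A); congr (_ + _).
rewrite -(card_imset _ (@lift_inj _ h)); apply: eq_card => x.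
rewrite !inE; apply/andP/imsetP => [[xh xA] | [j jA ->]]; last first.
  by rewrite inE in jA; rewrite eq_sym neq_lift.
case: (unliftP h x) xh xA => [j -> _ xA | ->]; last by rewrite eqxx.
by exists j; rewrite ?inE.
Qed.

(** The entries at position j of s and at the inserted position h, of value t,
    form a pair of direction b in [lift_perm h t s]. *)
Definition fits b n (s : 'S_n) (h t : 'I_n.+1) (j : 'I_n) : bool :=
  ((j < h) == (s j < t)) == b.

Lemma mono_lift b n (s : 'S_n) (h t : 'I_n.+1) (A : {set 'I_n.+1}) :
  mono b (lift_perm h t s) A =
  mono b s (restr h A) && ((h \in A) ==> [forall j in restr h A, fits b s h t j]).
Proof.
apply/monoP/andP => [H | [/monoP H1 H2] x y].
  split.
    apply/monoP => i j; rewrite !inE => iA jA lij.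
    by have := H _ _ iA jA; rewrite !lift_perm_lift !ltn_lift2 => ->.
  apply/implyP => hA; apply/forall_inP => j; rewrite inE => jA.
  have := H _ _ hA jA; have := H _ _ jA hA.
  rewrite !lift_perm_lift !lift_perm_id !ltn_liftl !ltn_liftr /fits.
  by case: (j < h) => /= [/(_ isT) -> _ | _ /(_ isT) <-]; case: (_ < _).
case: (unliftP h x) => [i ->|->]; case: (unliftP h y) => [j ->|->] xA yA.
- by rewrite !lift_perm_lift !ltn_lift2; apply: H1; rewrite inE.
- move/implyP/(_ yA)/forall_inP/(_ i): H2; rewrite inE xA => /(_ isT)/eqP.
  by rewrite !lift_perm_lift !lift_perm_id !ltn_liftl => <- ->; case: (_ < _).
- move/implyP/(_ xA)/forall_inP/(_ j): H2; rewrite inE yA => /(_ isT)/eqP.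
  rewrite !lift_perm_lift !lift_perm_id !ltn_liftr => <- /negPf ->.
  by case: (_ < _).
- by rewrite ltnn.
Qed.

(** A monotone subsequence of an extension either avoids the new entry, or
    becomes one shorter by dropping it. *)
Lemma contains_lift b m n (s : 'S_n) (h t : 'I_n.+1) :
  contains b m.+1 (lift_perm h t s) =
  contains b m.+1 s ||
  [exists A : {set 'I_n},
     [&& #|A| == m, mono b s A & [forall j in A, fits b s h t j]]].
Proof.
apply/existsP/orP => [[A] | [/existsP[A] | /existsP[A]]].
- rewrite (card_restr h) mono_lift; case: (h \in A) => /=.
    by move=> cA; right; apply/existsP; exists (restr h A).
  by rewrite andbT => cA; left; apply/existsP; exists (restr h A).
- pose B := lift h @: A.
  have hB : h \notin B.
    by apply/imsetP => -[j _ /eqP]; rewrite (negPf (neq_lift _ _)).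
  have rB : restr h B = A.
    by apply/setP => j; rewrite inE (mem_imset _ _ (@lift_inj _ h)).
  by move=> cA; exists B; rewrite (card_restr h) mono_lift rB (negPf hB) andbT.
- pose B := h |: lift h @: A.
  have rB : restr h B = A.
    apply/setP => j; rewrite !inE (mem_imset _ _ (@lift_inj _ h)).
    by rewrite eq_sym (negPf (neq_lift _ _)).
  by exists B; rewrite (card_restr h) mono_lift rB setU11.
Qed.

(** * A description of bicrucial permutations *)

Definition inc_below k n (s : 'S_n) t : bool :=
  [exists A : {set 'I_n},
     [&& #|A| == k, mono true s A & [forall j in A, s j < t]]].

Definition inc_above k n (s : 'S_n) t : bool :=
  [exists A : {set 'I_n},
     [&& #|A| == k, mono true s A & [forall j in A, t <= s j]]].

Definition inv_below n (s : 'S_n) t : bool :=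
  [exists i : 'I_n, exists j : 'I_n, [&& i < j, s j < s i & s i < t]].

Definition inv_above n (s : 'S_n) t : bool :=
  [exists i : 'I_n, exists j : 'I_n, [&& i < j, s j < s i & t <= s j]].

Lemma inversion_pair n (s : 'S_n) (P : pred 'I_n) :
  [exists A : {set 'I_n}, [&& #|A| == 2, mono false s A & [forall j in A, P j]]]
  = [exists i : 'I_n, exists j : 'I_n, [&& i < j, s j < s i, P i & P j]].
Proof.
apply/existsP/existsP => [[A /and3P[/cards2P[x [y [xy ->]]] /monoP mA /forall_inP PA]] |].
  have Px := PA _ (set21 x y); have Py := PA _ (set22 x y).
  have mxy := mA _ _ (set21 x y) (set22 x y).
  have myx := mA _ _ (set22 x y) (set21 x y).
  have nxy : s x != s y :> nat by rewrite perm_val_neq.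
  have : x != y :> nat by [].
  case: (ltngtP x y) mxy myx => // l mxy myx _; [exists x | exists y];
    apply/existsP; [exists y | exists x]; rewrite l Px Py !andbT /=; lia.
case=> i /existsP[j /and4P[lij sji Pi Pj]].
exists [set i; j]; apply/and3P; split.
- by rewrite cards2; have -> : i != j by apply: contraTneq lij => ->; rewrite ltnn.
- by apply/monoP => x y; rewrite !inE => /orP[]/eqP -> /orP[]/eqP -> //; lia.
- by apply/forall_inP => x; rewrite !inE => /orP[]/eqP ->.
Qed.

Lemma contains_ext_right k n (s : 'S_n) (t : 'I_n.+1) :
  ~~ contains_inc_or_dec k.+1 3 s ->
  contains_inc_or_dec k.+1 3 (ext_right s t) = inc_below k s t || inv_above s t.
Proof.
rewrite !contains_inc_or_decE negb_or => /andP[/negPf ni /negPf nd].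
rewrite !contains_lift ni nd /= inversion_pair; congr (_ || _).
  by apply: eq_existsb => A; do 2![congr (_ && _)];
     apply: eq_forallb_in => j _; rewrite /fits /= ltn_ord; case: (_ < _).
apply: eq_existsb => i; apply: eq_existsb => j; rewrite /fits /= !ltn_ord.
by lia.
Qed.

Lemma contains_ext_left k n (s : 'S_n) (t : 'I_n.+1) :
  ~~ contains_inc_or_dec k.+1 3 s ->
  contains_inc_or_dec k.+1 3 (ext_left s t) = inv_below s t || inc_above k s t.
Proof.
rewrite !contains_inc_or_decE negb_or => /andP[/negPf ni /negPf nd].
rewrite !contains_lift ni nd /= inversion_pair orbC; congr (_ || _).
  by apply: eq_existsb => i; apply: eq_existsb => j; rewrite /fits /=; lia.
by apply: eq_existsb => A; do 2![congr (_ && _)];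
   apply: eq_forallb_in => j _; rewrite /fits /=; lia.
Qed.

(** A discrete intermediate value argument: P increases from false, Q decreases
    to false, and at the last t where P fails Q must still hold. *)
Lemma cover_crossing n (P Q : pred nat) :
  {homo P : x y / x <= y >-> x ==> y} -> {homo Q : x y / y <= x >-> x ==> y} ->
  ~~ P 0 -> ~~ Q n ->
  [forall t : 'I_n.+1, P t || Q t] = [exists t : 'I_n, P t.+1 && Q t].
Proof.
move=> mP mQ P0 Qn; apply/forallP/existsP => [H | [t /andP[Pt Qt]] u].
  have PQ t : t <= n -> P t || Q t by move=> ltn; have := H (inord t); rewrite inordK.
  have exP : exists t, P t by exists n; have := PQ n (leqnn n); rewrite (negPf Qn) orbF.
  case: (ex_minnP exP) => -[|t] Pt minP; first by rewrite Pt in P0.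
  have ltn : t < n.
    by apply: minP; have := PQ n (leqnn n); rewrite (negPf Qn) orbF.
  exists (Ordinal ltn); rewrite /= Pt.
  have := PQ t (ltnW ltn); case Pt' : (P t) => //.
  by have := minP t Pt'; rewrite ltnn.
case: (ltnP t u) => lut; first by have := mP _ _ lut; rewrite Pt /= => ->.
by have := mQ _ _ lut; rewrite Qt /= => ->; rewrite orbT.
Qed.

(** The pattern i_k gets length at least 2, so that the increasing subsequences
    considered are nonempty; otherwise the crossing argument has no starting
    point. *)
Lemma bicrucialE k n (s : 'S_n) :
  bicrucial k.+2 3 s =
  [&& ~~ contains_inc_or_dec k.+2 3 s,
      [exists t : 'I_n, inc_below k.+1 s t.+1 && inv_above s t] &
      [exists u : 'I_n, inv_below s u.+1 && inc_above k.+1 s u]].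
Proof.
rewrite /bicrucial.
case av: (contains_inc_or_dec k.+2 3 s); rewrite ?andbF //=.
case: (posnP n) => [n0 | n_gt0] /=.
  by subst n; symmetry; apply/negP => /andP[/existsP[[]]].
rewrite -!cover_crossing.
- by congr (_ && _); apply: eq_forallb => t;
    rewrite ?contains_ext_right ?contains_ext_left ?av.
- move=> x y xy; apply/implyP => /existsP[i /existsP[j /and3P[lij sji ix]]].
  by apply/existsP; exists i; apply/existsP; exists j; rewrite lij sji (leq_trans ix).
- move=> x y xy; apply/implyP => /existsP[A /and3P[cA mA /forall_inP A_x]].
  apply/existsP; exists A; rewrite cA mA; apply/forall_inP => j jA.
  exact: leq_trans (A_x j jA).
- by apply/existsP => -[i /existsP[j /and3P[]]].
- apply/existsP => -[A /and3P[/eqP cA _ /forall_inP A_n]].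
  have /card_gt0P[j jA] : 0 < #|A| by rewrite cA.
  by have := A_n j jA; rewrite leqNgt ltn_ord.
- move=> x y xy; apply/implyP => /existsP[A /and3P[cA mA /forall_inP A_x]].
  apply/existsP; exists A; rewrite cA mA; apply/forall_inP => j jA.
  exact: leq_trans (A_x j jA) xy.
- move=> x y xy; apply/implyP => /existsP[i /existsP[j /and3P[lij sji ix]]].
  by apply/existsP; exists i; apply/existsP; exists j; rewrite lij sji (leq_trans xy).
- apply/existsP => -[A /and3P[/eqP cA _ /forall_inP A_n]].
  have /card_gt0P[j jA] : 0 < #|A| by rewrite cA.
  by have := A_n j jA.
- by apply/existsP => -[i /existsP[j /and3P[_ _]]]; rewrite leqNgt ltn_ord.
Qed.

(** * Complementation *)

Definition compl n (s : 'S_n) : 'S_n := (s * perm (@rev_ord_inj n))%g.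

Lemma complE n (s : 'S_n) i : compl s i = rev_ord (s i).
Proof. by rewrite permM permE. Qed.

Lemma compl_inj n : injective (@compl n).
Proof. exact: mulIg. Qed.

Lemma mono_compl b n (s : 'S_n) A : mono b (compl s) A = mono (~~ b) s A.
Proof.
apply: eq_forallb_in => i _; apply: eq_forallb_in => j _; case: ltnP => //= lij.
have : s i != s j :> nat by rewrite perm_val_neq // ltn_eqF.
rewrite !complE /=; have := ltn_ord (s i); have := ltn_ord (s j).
by case: b; lia.
Qed.

Lemma contains_inc_or_dec_compl k l n (s : 'S_n) :
  contains_inc_or_dec k l (compl s) = contains_inc_or_dec l k s.
Proof.
rewrite !contains_inc_or_decE orbC; congr (_ || _);
  by apply: eq_existsb => A; rewrite mono_compl.
Qed.

Lemma lift_rev_ord n (t : 'I_n.+1) (x : 'I_n) :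
  lift t (rev_ord x) = rev_ord (lift (rev_ord t) x).
Proof.
by apply/val_inj; rewrite /= /bump; have := ltn_ord x; have := ltn_ord t; lia.
Qed.

Lemma lift_perm_compl n (s : 'S_n) h t :
  lift_perm h t (compl s) = compl (lift_perm h (rev_ord t) s).
Proof.
apply/permP => x; rewrite complE; case: (unliftP h x) => [j|] ->.
  by rewrite !lift_perm_lift complE lift_rev_ord.
by rewrite !lift_perm_id rev_ordK.
Qed.

(** Complementation exchanges the two patterns and maps extensions of s to
    extensions of its complement. *)
Lemma bicrucial_compl k l n (s : 'S_n) :
  bicrucial k l (compl s) = bicrucial l k s.
Proof.
rewrite /bicrucial contains_inc_or_dec_compl; congr [&& _, _, _ & _];
  apply/forallP/forallP => H t; have := H (rev_ord t);
  by rewrite /ext_right /ext_left lift_perm_compl ?rev_ordK contains_inc_or_dec_compl.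
Qed.

(** * Shape of the minimal bicrucial permutations *)

Lemma card_ord_lt n b : b <= n -> #|[set i : 'I_n | i < b]| = b.
Proof.
move=> lbn; rewrite -[RHS](card_ord b) -cardsT.
have inj : injective (widen_ord lbn) by move=> i j /(congr1 val) /= /val_inj.
rewrite -(card_imset _ inj); apply: eq_card => i.
rewrite !inE; apply/idP/imsetP => [lib | [j _ ->]]; last by rewrite /= ltn_ord.
by exists (Ordinal lib); rewrite ?inE //; apply: val_inj.
Qed.

Lemma card_values_lt n (s : 'S_n) b : b <= n -> #|[set i | s i < b]| = b.
Proof.
move=> lbn; rewrite -[RHS](card_ord_lt lbn) -(card_imset _ (@perm_inj _ s)).
apply: eq_card => x; rewrite !inE; apply/imsetP/idP => [[i + ->]|lxb].
  by rewrite inE.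
by exists (s^-1%g x); rewrite ?inE permKV.
Qed.

Lemma card_values_ge n (s : 'S_n) b : b <= n -> #|[set i | b <= s i]| = n - b.
Proof.
move=> lbn; rewrite -[X in _ = X - _](card_ord n) -(cardsC [set i | s i < b]).
rewrite (card_values_lt s lbn) addKn.
by apply: eq_card => i; rewrite !inE leqNgt.
Qed.

Lemma mono_inv n (s : 'S_n) (A : {set 'I_n}) (i j : 'I_n) :
  mono true s A -> i \in A -> j \in A -> s i < s j -> i < j.
Proof.
move=> /monoP mA iA jA; case: (ltngtP i j) => [//| lji | /val_inj ->].
  by have := mA _ _ jA iA lji; case: ltngtP.
by rewrite ltnn.
Qed.

Lemma mono_inversion n (s : 'S_n) (A : {set 'I_n}) (i j : 'I_n) :
  mono true s A -> i < j -> s j < s i -> ~ (i \in A /\ j \in A).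
Proof. by move=> /monoP mA lij sji [iA jA]; have := mA _ _ iA jA lij; lia. Qed.

(** Values at most b - 1 leave room for only b positions; when they are all used
    the set is determined. *)
Lemma below_full n (s : 'S_n) (A : {set 'I_n}) b :
  b <= n -> {in A, forall x, s x < b} ->
  #|A| <= b /\ (#|A| = b -> forall x, (x \in A) = (s x < b)).
Proof.
move=> lbn A_b; have cC := card_values_lt s lbn.
have sAC : A \subset [set x | s x < b].
  by apply/fintype.subsetP => x /A_b; rewrite inE.
split=> [|cA x]; first by rewrite -[leqRHS]cC subset_leq_card.
have /eqP -> : A == [set x | s x < b] by rewrite eqEcard sAC cC cA leqnn.
by rewrite inE.
Qed.

Lemma above_full n (s : 'S_n) (A : {set 'I_n}) b :
  b <= n -> {in A, forall x, b <= s x} ->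
  #|A| <= n - b /\ (#|A| = n - b -> forall x, (x \in A) = (b <= s x)).
Proof.
move=> lbn A_b; have cC := card_values_ge s lbn.
have sAC : A \subset [set x | b <= s x].
  by apply/fintype.subsetP => x /A_b; rewrite inE.
split=> [|cA x]; first by rewrite -[leqRHS]cC subset_leq_card.
have /eqP -> : A == [set x | b <= s x] by rewrite eqEcard sAC cC cA leqnn.
by rewrite inE.
Qed.

(** The crossing points of the criterion are eliminated here: what remains is an
    increasing subsequence lying weakly below an inversion, and one lying weakly
    above an inversion. *)
Lemma bicrucial_witness k n (s : 'S_n) : bicrucial k.+2 3 s ->
  (exists (A : {set 'I_n}) (i j : 'I_n), [/\ #|A| = k.+1, mono true s A, i < j, s j < s i
                   & forall x, x \in A -> s x <= s j]) /\
  (exists (A : {set 'I_n}) (i j : 'I_n), [/\ #|A| = k.+1, mono true s A, i < j, s j < s i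
                   & forall x, x \in A -> s i <= s x]).
Proof.
rewrite bicrucialE => /and3P[_ /existsP[t /andP[]] + + /existsP[u /andP[]]].
move=> /existsP[A /and3P[/eqP cA mA /forall_inP A_t]].
move=> /existsP[i /existsP[j /and3P[lij sji tj]]].
move=> /existsP[i' /existsP[j' /and3P[lij' sji' ui']]].
move=> /existsP[B /and3P[/eqP cB mB /forall_inP B_u]].
split; [exists A, i, j | exists B, i', j']; split=> // x.
  by move/A_t => xt; apply: leq_trans tj; rewrite -ltnS.
by move/B_u; apply: leq_trans; rewrite -ltnS.
Qed.

(** The shape of the minimal permutations for k = m + 2, up to complementation
    when m = 1. *)
Definition ends_swapped m (s : 'S_m.+3) : Prop :=
  [/\ forall i j : 'I_m.+3, 0 < s i -> s i < s j -> s j < m.+2 -> i < j,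
      forall i j : 'I_m.+3, s i = 1 :> nat -> s j = 0 :> nat -> i < j,
      forall i j : 'I_m.+3, s i = m.+2 :> nat -> s j = m.+1 :> nat -> i < j
    & ~~ contains false 3 s].

(** In length k the subsequence below the first inversion would consist of all
    the values up to k - 2; the second inversion uses only values at most 1, so
    this increasing subsequence would contain it. *)
Lemma bicrucial_length m n (s : 'S_n) :
  0 < m -> bicrucial m.+2 3 s -> m.+2 < n.
Proof.
move=> m_gt0 /bicrucial_witness[[A [i [j [cA mA lij sji Aj]]]]].
move=> [B [i' [j' [cB _ lij' sji' Bi']]]].
have [l1 fullA] := below_full (ltn_ord (s j)) Aj.
have [l2 _] := above_full (ltnW (ltn_ord (s i'))) Bi'.
have lin := ltn_ord (s i); rewrite cA in l1 fullA; rewrite cB in l2.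
rewrite ltnNge; apply/negP => ln.
by apply: (mono_inversion mA lij' sji'); rewrite !fullA; lia.
Qed.

(** Let A be an increasing subsequence with k - 1 of the values 0, ..., k - 1.
    The inversion (1, 0) keeps one of 0 and 1 out of A, so A contains all of
    2, ..., k - 1. If 1 is missing, then 0 is in A and, coming after 1, still
    shows that 1 precedes the rest. *)
Lemma middle_increasing m (s : 'S_m.+3) (A : {set 'I_m.+3}) (i0 i1 : 'I_m.+3) :
  #|A| = m.+1 -> mono true s A -> {in A, forall x, s x < m.+2} ->
  i1 < i0 -> s i1 = 1 :> nat -> s i0 = 0 :> nat ->
  forall x y : 'I_m.+3, 0 < s x -> s x < s y -> s y < m.+2 -> x < y.
Proof.
move=> cA mA Am l10 s1 s0.
have /eqP/cards1P[z ez] : #|[set x | s x < m.+2] :\: A| = 1.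
  rewrite cardsDS ?cA ?card_values_lt //; first by rewrite subSS subSn // subnn.
  by apply/fintype.subsetP => x /Am; rewrite inE.
have inA x : s x < m.+2 -> x != z -> x \in A.
  move=> lx; apply: contraNT => xA.
  have : x \in [set x | s x < m.+2] :\: A by rewrite !inE xA.
  by rewrite ez inE.
have z01 : z = i1 \/ z = i0.
  case: (eqVneq i1 z) => [-> | /inA iA]; first by left.
  case: (eqVneq i0 z) => [-> | /inA jA]; first by right.
  by case: (mono_inversion mA l10); rewrite ?s0 ?s1 // iA ?jA ?s0 ?s1.
have big x : 1 < s x -> s x < m.+2 -> x \in A.
  move=> l1 l2; apply: inA => //; apply: contraTneq l1 => ->.
  by case: z01 => ->; rewrite ?s0 ?s1.
move=> x y x_gt0 lxy ym.
have yA : y \in A by apply: big => //; apply: leq_ltn_trans lxy.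
have [x_gt1 | x_le1] := ltnP 1 (s x).
  by apply: (mono_inv mA) => //; apply: big => //; apply: ltn_trans ym.
have sx : s x = 1 :> nat by apply/eqP; rewrite eqn_leq x_le1.
have -> : x = i1 by apply/(@perm_inj _ s)/val_inj; rewrite /= sx s1.
have i10 : i1 != i0 by rewrite -val_eqE /= ltn_eqF.
rewrite sx in lxy; case: z01 => zE.
  apply: (ltn_trans l10); apply: (mono_inv mA) => //; last by rewrite s0 ltnW.
  by apply: inA; rewrite ?s0 // zE eq_sym.
apply: (mono_inv mA) => //; last by rewrite s1.
by apply: inA; rewrite ?s1 // zE.
Qed.

(** Complementation reverses values: 0 before 1 and 2 before 3 become the two
    swapped ends. Since 0 precedes 1, an inversion of 2 with 0 or 1 puts 2 before
    1, which becomes the increasing middle. *)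
Lemma ends_swapped_compl (s : 'S_4) :
  ~~ contains true 3 s ->
  (forall x y : 'I_4, s x < s y -> s y < 2 -> x < y) ->
  (forall x y : 'I_4, 2 <= s x -> s x < s y -> x < y) ->
  (exists i j : 'I_4, [/\ i < j, s i = 2 :> nat & s j < 2]) ->
  ends_swapped (compl s).
Proof.
move=> av lo hi [i [j [lij si sj]]]; split; last first.
  have -> : contains false 3 (compl s) = contains true 3 s.
    by apply: eq_existsb => X; rewrite mono_compl.
  by [].
all: move=> x y; rewrite !complE /= !subSS;
  have lx := ltn_ord (s x); have ly := ltn_ord (s y).
- by move=> sx sy; apply: lo; lia.
- by move=> sx sy; apply: hi; lia.
move=> sx sxy sy; have -> : x = i.
  by apply/(@perm_inj _ s)/val_inj; move: sx sxy sy si => /=; lia.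
have [-> // | yj] := eqVneq y j.
apply: (ltn_trans lij); apply: lo; last by lia.
have : s y != s j :> nat by rewrite perm_val_neq.
by lia.
Qed.

(** Let t be the smaller value of the inversion above A. Counting leaves t = k - 1
    or t = k - 2. If t = k - 1 the inversion is (k, k - 1), and the other one must
    be (1, 0), because otherwise B would contain both k - 1 and k. If t = k - 2
    then A consists of all the values up to k - 2, so the inversion below B, whose
    values are at most 2, leaves this range: k = 3. *)
Lemma bicrucial_shape m (s : 'S_m.+3) : 0 < m -> bicrucial m.+2 3 s ->
  ends_swapped s \/ (m = 1 /\ ends_swapped (compl s)).
Proof.
move=> m_gt0 bs; have := bs; rewrite bicrucialE => /andP[+ _].
rewrite contains_inc_or_decE negb_or => /andP[ni nd].
have [[A [i [j [cA mA lij sji Aj]]]]] := bicrucial_witness bs.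
move=> [B [i' [j' [cB mB lij' sji' Bi']]]].
have [l1 fullA] := below_full (ltn_ord (s j)) Aj.
have [l2 fullB] := above_full (ltnW (ltn_ord (s i'))) Bi'.
have lin := ltn_ord (s i); rewrite cA in l1 fullA; rewrite cB in l2 fullB.
have invA := mono_inversion mA lij' sji'.
have invB := mono_inversion mB lij sji.
have same x y : s x = s y :> nat -> x = y by move=> /val_inj/perm_inj.
have [sj | sj] : s j = m.+1 :> nat \/ s j = m :> nat by clear -l1 sji lin; lia.
  have si : s i = m.+2 :> nat by clear -sji sj lin; lia.
  have si' : s i' = 1 :> nat.
    apply: contra_notP invB => si'; have {si'} si' : s i' = 2 :> nat.
      by clear -si' l2 sji'; lia.
    by rewrite !fullB si' ?si ?sj //; clear -m_gt0; lia.
  have sj' : s j' = 0 :> nat by clear -si' sji'; lia.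
  left; split=> //.
  - by apply: (middle_increasing cA mA _ lij' si' sj') => x /Aj; rewrite sj.
  - by move=> x y sx sy; rewrite (same x i') ?sx ?si' // (same y j') ?sy ?sj'.
  - by move=> x y sx sy; rewrite (same x i) ?sx ?si // (same y j) ?sy ?sj.
rewrite sj in fullA; have {}fullA := fullA erefl.
have lmi : m < s i'.
  rewrite ltnNge; apply/negP => lim; apply: invA.
  by rewrite !fullA !ltnS lim (leq_trans (ltnW sji')).
have m1 : m = 1 by clear -lmi l2 m_gt0; lia.
subst m; have si' : s i' = 2 :> nat by clear -lmi l2; lia.
rewrite si' in fullB sji'; have {}fullB := fullB erefl.
right; split=> //; apply: ends_swapped_compl => //.
- move=> x y lxy ly; apply: (mono_inv mA) => //; rewrite fullA //.
  exact: ltn_trans ly.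
- move=> x y lx lxy; apply: (mono_inv mB) => //; rewrite fullB //.
  exact: leq_trans (ltnW lxy).
- by exists i', j'.
Qed.

(** The subsequence of the values 1, ..., k - 1 witnesses both halves of the
    criterion. An increasing subsequence of length k would omit one position only,
    but it must omit one from each of the disjoint inversions (1, 0) and
    (k, k - 1). *)
Lemma ends_swapped_bicrucial m (s : 'S_m.+3) : 0 < m -> ends_swapped s -> bicrucial m.+2 3 s.
Proof.
move=> m_gt0 [mid low high nd].
pose at_ v := (s^-1)%g (inord v : 'I_m.+3).
have s_at v : v < m.+3 -> s (at_ v) = v :> nat by move=> lv; rewrite permKV inordK.
have s0 := s_at 0 isT; have s1 := s_at 1 isT.
have sM := s_at m.+2 (ltnSn _); have sm := s_at m.+1 (ltnW (ltnSn _)).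
have l10 : at_ 1 < at_ 0 by apply: low.
have lMm : at_ m.+2 < at_ m.+1 by apply: high.
pose M := [set i | s i < m.+2] :\: [set i | s i < 1].
have cM : #|M| = m.+1.
  rewrite cardsDS ?card_values_lt ?subn1 //.
  by apply/fintype.subsetP => x; rewrite !inE => /leq_trans ->.
have mM : mono true s M.
  apply/monoP => i j; rewrite !inE -!leqNgt => /andP[i0 iM] /andP[j0 jM] lij.
  case: (ltngtP (s i) (s j)) => // [l|]; first by have := mid _ _ j0 l iM; lia.
  by move=> /val_inj/perm_inj e; rewrite e ltnn in lij.
rewrite bicrucialE contains_inc_or_decE negb_or nd andbT; apply/and3P; split.
- apply/existsP => -[A /andP[/eqP cA mA]].
  have /eqP/cards1P[z ez] : #|~: A| = 1.
    by have := cardsC A; rewrite cA card_ord; lia.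
  have inA x : x != z -> x \in A.
    by apply: contraNT; rewrite -finset.in_setC ez inE.
  have pairz (i j : 'I_m.+3) : i < j -> s j < s i -> z = i \/ z = j.
    move=> lij sji; case: (eqVneq i z) => [->|/inA iA]; first by left.
    case: (eqVneq j z) => [->|/inA jA]; first by right.
    by case: (mono_inversion mA lij sji).
  have z_low : s z <= 1.
    by case: (pairz _ _ l10) => [|->|->]; rewrite ?s0 ?s1.
  have z_high : m < s z.
    by case: (pairz _ _ lMm) => [|->|->]; rewrite ?sm ?sM.
  by lia.
- apply/existsP; exists (Ordinal (ltnW (ltnSn m.+2))); apply/andP; split.
    apply/existsP; exists M; rewrite cM eqxx mM.
    by apply/forall_inP => x; rewrite !inE => /andP[].
  apply/existsP; exists (at_ m.+2); apply/existsP; exists (at_ m.+1).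
  by rewrite lMm sM sm /= ltnSn leqnn.
- apply/existsP; exists (Ordinal (isT : 1 < m.+3)); apply/andP; split.
    apply/existsP; exists (at_ 1); apply/existsP; exists (at_ 0).
    by rewrite l10 s0 s1.
  apply/existsP; exists M; rewrite cM eqxx mM.
  by apply/forall_inP => x; rewrite !inE -leqNgt => /andP[].
Qed.

(** * Parametrization by two insertions *)

Lemma lift_perm_surj n (s : 'S_n.+1) i j :
  s i = j -> exists t, s = lift_perm i j t.
Proof.
move=> <-; pose f k := odflt k (unlift (s i) (s (lift i k))).
have fK k : lift (s i) (f k) = s (lift i k).
  rewrite /f; have := neq_lift i k.
  by rewrite -(inj_eq (@perm_inj _ s)) => /unlift_some[? ? ->].
have f_inj : injective f.
  by move=> x y /(congr1 (lift (s i))); rewrite !fK => /perm_inj/lift_inj.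
exists (perm f_inj); apply/permP => k.
by case: (unliftP i k) => [x|] ->; rewrite ?lift_perm_id // lift_perm_lift permE fK.
Qed.

Lemma increasing_perm n (s : 'S_n) :
  (forall i j : 'I_n, s i < s j -> i < j) -> s = 1%g.
Proof.
move=> inc; apply/permP => x; rewrite perm1; apply: val_inj => /=.
rewrite -[RHS](@card_ord_lt n x) ?(ltnW (ltn_ord x)) //.
rewrite -[LHS](@card_values_lt n s (s x)) ?(ltnW (ltn_ord _)) //.
apply: eq_card => i; rewrite !inE; apply/idP/idP => [/inc //|lix].
case: (ltngtP (s i) (s x)) => // [/inc|/val_inj/perm_inj e]; first lia.
by rewrite e ltnn in lix.
Qed.

(** The word 1, ..., m + 1 with m + 2 inserted at position q, and then 0 inserted
    at position p of the result. *)
Definition sandwich m (p : 'I_m.+3) (q : 'I_m.+2) : 'S_m.+3 :=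
  lift_perm p ord0 (lift_perm q ord_max 1).

Lemma sandwich0 m (p : 'I_m.+3) (q : 'I_m.+2) : sandwich p q p = 0 :> nat.
Proof. by rewrite lift_perm_id. Qed.

Lemma sandwich_max m (p : 'I_m.+3) (q : 'I_m.+2) :
  sandwich p q (lift p q) = m.+2 :> nat.
Proof. by rewrite lift_perm_lift lift_perm_id. Qed.

Lemma sandwich_mid m (p : 'I_m.+3) (q : 'I_m.+2) (x : 'I_m.+1) :
  sandwich p q (lift p (lift q x)) = x.+1 :> nat.
Proof. by rewrite !lift_perm_lift perm1 lift0 lift_max. Qed.

Lemma sandwich_inj m (p p' : 'I_m.+3) (q q' : 'I_m.+2) :
  sandwich p q = sandwich p' q' -> (p, q) = (p', q').
Proof.
move=> e; have pp : p = p'.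
  apply: (@perm_inj _ (sandwich p q)); apply: val_inj.
  by rewrite /= sandwich0 e sandwich0.
subst p'; congr (_, _); apply: (@lift_inj _ p).
apply: (@perm_inj _ (sandwich p q)); apply: val_inj.
by rewrite /= sandwich_max e sandwich_max.
Qed.

Lemma sandwich_surj m (s : 'S_m.+3) : ends_swapped s -> exists p q, s = sandwich p q.
Proof.
case=> mid _ _ _; exists (s^-1%g ord0).
have [t et] := @lift_perm_surj _ s (s^-1%g ord0) ord0 (permKV _ _).
have [r er] := @lift_perm_surj _ t (t^-1%g ord_max) ord_max (permKV _ _).
exists (t^-1%g ord_max); set p := s^-1%g _ in et *; set q := t^-1%g _ in er *.
suff r1 : r = 1%g by rewrite et er r1.
apply: increasing_perm => i j lij.
have sE x : s (lift p (lift q x)) = (r x).+1 :> nat.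
  by rewrite et er !lift_perm_lift lift0 lift_max.
have := mid (lift p (lift q i)) (lift p (lift q j)); rewrite !sE !ltn_lift2.
by apply=> //; rewrite ltnS ltn_ord.
Qed.

Lemma no_inversion_id n (P : rel 'I_n) :
  [exists i : 'I_n, exists j : 'I_n,
     [&& i < j, (1%g : 'S_n) j < (1%g : 'S_n) i & P i j]] = false.
Proof.
by apply/existsP => -[i /existsP[j]]; rewrite !perm1 => /and3P[]; lia.
Qed.

(** A decreasing triple must use the maximum, one of the increasing middle values,
    and 0; it exists when a middle value separates position q from position p. *)
Lemma contains_dec_sandwich m (p : 'I_m.+3) (q : 'I_m.+2) :
  contains false 3 (sandwich p q) = (q.+1 < p).
Proof.
rewrite !contains_lift !inversion_pair no_inversion_id orbF.
have -> : contains false 3 (1%g : 'S_m.+1) = false.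
  apply/existsP => -[A /andP[/eqP cA /monoP mA]].
  have /card_gt1P[x [y [xA yA]]] : 1 < #|A| by rewrite cA.
  rewrite neq_ltn => /orP[l|l]; [have := mA _ _ xA yA l|have := mA _ _ yA xA l];
    by rewrite !perm1 l.
rewrite /= /fits; apply/existsP/idP => [[i /existsP[j]]|lqp].
  rewrite /= !eqbF_neg.

  case: (unliftP q j) => [y ->|->]; last first.
    by rewrite lift_perm_id => /and4P[_]; rewrite ltnNge -ltnS ltn_ord.

  case: (unliftP q i) => [x ->|->].
    by rewrite !lift_perm_lift !perm1 !lift_max !ltn_lift2 => /and4P[]; lia.
  by rewrite /= /bump => /and4P[]; lia.
have lqm : q < m.+1 by have := ltn_ord p; lia.
exists q; apply/existsP; exists (lift q (Ordinal lqm)).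
rewrite lift_perm_id lift_perm_lift perm1 lift_max /= /bump leqnn.
by rewrite lqm; apply/and3P; split; lia.
Qed.

(** The order of the two largest values gives q <= m, and the avoidance of d_3
    gives p <= q + 1. The order of 1 and 0 gives 0 < p, and even 2 <= p when
    q = 0, since 1 then follows the maximum; so p <= q + 1 forces 0 < q. *)
Lemma ends_swapped_sandwich m (p : 'I_m.+3) (q : 'I_m.+2) :
  ends_swapped (sandwich p q) <-> (0 < q <= m) && (0 < p <= q.+1).
Proof.
split.
  case=> _ low high; rewrite contains_dec_sandwich => pq.
  have := low (lift p (lift q ord0)) p (sandwich_mid _ _ _) (sandwich0 _ _).
  rewrite ltn_liftl.
  have := high (lift p q) (lift p (lift q ord_max)) (sandwich_max _ _) (sandwich_mid _ _ _).
  rewrite ltn_lift2 /= /bump; have := ltn_ord q; lia.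
move=> cpq; split; last by rewrite contains_dec_sandwich; lia.
all: move=> i j; case: (unliftP p i) => [i' ->|->]; rewrite ?sandwich0;
  try (case: (unliftP q i') => [x ->|->]; rewrite ?sandwich_max ?sandwich_mid);
  case: (unliftP p j) => [j' ->|->]; rewrite ?sandwich0;
  try (case: (unliftP q j') => [y ->|->]; rewrite ?sandwich_max ?sandwich_mid);
  try have := ltn_ord x; try have := ltn_ord y; rewrite /= /bump; lia.
Qed.

(** * Counting *)

Definition gaps m : {set 'I_m.+3 * 'I_m.+2} :=
  [set pq : 'I_m.+3 * 'I_m.+2 | (0 < pq.2 <= m) && (0 < pq.1 <= pq.2.+1)].

Lemma sum_between n b : b < n -> \sum_(i < n) (0 < i <= b) = b.
Proof.
move=> lbn; transitivity (minn n.-1 b); last by lia.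
elim: n {lbn} => [|n IH]; first by rewrite big_ord0 min0n.
by rewrite big_ord_recr /= IH; lia.
Qed.

Lemma card_gaps m : #|gaps m| * 2 = (m + 3) * m.
Proof.
transitivity ((\sum_(q < m.+2) (0 < q <= m) * q.+1) * 2).
  congr (_ * 2); rewrite -sum1_card big_mkcond /=.
  transitivity (\sum_(p < m.+3) \sum_(q < m.+2) ((p, q) \in gaps m)).
    by rewrite pair_big /=; apply: eq_bigr => -[p q] _ /=; case: ifP.
  rewrite exchange_big /=; apply: eq_bigr => q _.
  under eq_bigr do rewrite inE /=.
  case: (boolP (0 < q <= m)) => [/andP[_ qm] | _] /=.
    by rewrite mul1n sum_between //; lia.
  by rewrite big1.
rewrite big_ord_recr /= ltnn mul0n addn0.
have -> : \sum_(q < m.+1) (0 < q <= m) * q.+1 = \sum_(q < m.+1) (0 < q) * q.+1.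
  by apply: eq_bigr => q _; rewrite leq_ord andbT.
elim: m => [|m IH]; first by rewrite big_ord1.
rewrite big_ord_recr /= mulnDl IH; lia.
Qed.

Definition ends_swapped_set m : {set 'S_m.+3} := [set sandwich pq.1 pq.2 | pq in gaps m].

Lemma ends_swapped_setP m (s : 'S_m.+3) : reflect (ends_swapped s) (s \in ends_swapped_set m).
Proof.
apply: (iffP imsetP) => [[[p q] + ->] | cs].
  by rewrite inE => /ends_swapped_sandwich.
have [p [q e]] := sandwich_surj cs; exists (p, q) => //.
by rewrite inE; apply/ends_swapped_sandwich; rewrite -e.
Qed.

Lemma card_ends_swapped_set m : #|ends_swapped_set m| * 2 = (m + 3) * m.
Proof. by rewrite card_imset ?card_gaps // => -[p q] [p' q'] /sandwich_inj. Qed.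

(** The complements matter only for k = 3, which is m = 1. *)
Definition minimal_set m : {set 'S_m.+3} :=
  ends_swapped_set m :|: (if m == 1 then @compl _ @: ends_swapped_set m else finset.set0).

Lemma minimal_setE m (s : 'S_m.+3) :
  0 < m -> (s \in minimal_set m) = bicrucial m.+2 3 s.
Proof.
move=> m_gt0; rewrite inE; apply/idP/idP => [/orP[/ends_swapped_setP|]|].
- exact: ends_swapped_bicrucial.
- case: eqP => [m1|]; last by rewrite inE.
  case/imsetP => t /ends_swapped_setP ct ->; move: (ends_swapped_bicrucial m_gt0 ct).
  by subst m; rewrite bicrucial_compl.
- case/bicrucial_shape => // [/ends_swapped_setP -> // | [m1 /ends_swapped_setP cs]].
  apply/orP; right; rewrite (introT eqP m1); apply/imsetP; exists (compl s) => //.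
  by apply/permP => x; rewrite !complE rev_ordK.
Qed.

(** In s the value 1 precedes 0; complementation turns these values into 2 and 3,
    and 3 would have to precede 2. *)
Lemma ends_swapped_complF (s : 'S_4) : ends_swapped s -> ends_swapped (compl s) -> False.
Proof.
case=> _ low _ _ [_ _ high _].
pose at_ v := (s^-1)%g (inord v : 'I_4).
have s_at v : v < 4 -> s (at_ v) = v :> nat by move=> lv; rewrite permKV inordK.
have := low (at_ 1) (at_ 0); rewrite !s_at // => /(_ erefl erefl).
have := high (at_ 0) (at_ 1); rewrite !complE /= !s_at // => /(_ erefl erefl).
by case: ltngtP.
Qed.

Lemma card_minimal_set m :
  #|minimal_set m| = (1 + (m == 1)) * (m + 3) * m %/ 2.
Proof.
rewrite -mulnA -card_ends_swapped_set mulnA mulnK //.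
rewrite /minimal_set; case: eqP => [m1 | _]; last by rewrite finset.setU0 mul1n.
subst m; rewrite cardsU (card_imset _ (@compl_inj _)).
rewrite (_ : _ :&: _ = finset.set0) ?cards0; first by rewrite subn0 addnn -mul2n.
apply/setP => s; rewrite !inE; apply/negP => /andP[/ends_swapped_setP c1].
case/imsetP => t /ends_swapped_setP ct e.
by apply: (ends_swapped_complF ct); rewrite -e.
Qed.

(** Length m + 3 is a lower bound, and it is attained because there is an
    [ends_swapped] permutation. *)
Lemma minimal_bicrucial_setE m : 0 < m ->
  minimal_bicrucial_set m.+2 3 =
  ([set existT (fun n => 'S_n) m.+3 s | s in [set` minimal_set m]])%classic.
Proof.
move=> m_gt0; apply/seteqP; split=> [[n s] /= [bs min_n] | _ [s + <-]] /=.
  have ln : m.+2 < n := bicrucial_length m_gt0 bs.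
  have [t bt] : exists t : 'S_m.+3, bicrucial m.+2 3 t.
    have /card_gt0P[t] : 0 < #|ends_swapped_set m|.
      by have := card_ends_swapped_set m; case: #|_| => //; rewrite mul0n; lia.
    by move/ends_swapped_setP/ends_swapped_bicrucial => bt; exists t; apply: bt.
  have nE : n = m.+3.
    by apply/eqP; rewrite eqn_leq ln andbT leqNgt; apply: contraL bt => /min_n; apply.
  by subst n; exists s; rewrite //= minimal_setE.
rewrite /= minimal_setE // => bs; split=> // n u.
by rewrite ltnNge; apply: contra; apply: bicrucial_length.
Qed.

Lemma card_finset_image (T : finType) (U : Type) (f : T -> U) (B : {set T}) :
  injective f -> ((f @` [set` B])%classic #= `I_#|B|)%card.
Proof.
move=> f_inj; apply: card_eq_trans (inj_card_eq _) _; first by move=> ? ? _ _ /f_inj.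
have [t0 tB | B0] := pickP [in B]; last first.
  rewrite eq_card0 // II0 card_eq0; apply/eqP/seteqP; split=> // t /=.
  by move=> tB; have := B0 t; rewrite /= tB.
rewrite card_eq_sym.
rewrite -(_ : ((nth t0 (enum B)) @` `I_#|B|)%classic = [set` B]%classic).
  rewrite card_eq_sym; apply: inj_card_eq => i j.
  rewrite !mem_setE /= => iB jB /eqP.
  by rewrite nth_uniq ?enum_uniq -?cardE // => /eqP.
apply/seteqP; split=> [_ [i /= iB <-] | t /= tB'].
  by rewrite -mem_enum mem_nth // -cardE.
exists (index t (enum B)); rewrite /= ?nth_index ?mem_enum //.
by rewrite cardE index_mem mem_enum.
Qed.

Lemma card_minimal_bicrucial k : 3 <= k ->
  (minimal_bicrucial_set k 3
     #= `I_((1 + (k == 3)) * (k + 1) * (k - 2) %/ 2))%card.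
Proof.
case: k => [|[|[|m]]] // _.
have -> : (1 + (m.+3 == 3)) * (m.+3 + 1) * (m.+3 - 2) %/ 2 = #|minimal_set m.+1|.
  by rewrite card_minimal_set addn1 addn3 !subSS subn0 !eqSS.
rewrite minimal_bicrucial_setE //.
apply: card_finset_image => s t e.
exact: boolp.existT_inj2 e.
Qed.

Theorem corollary22 :
  (forall k : nat, 3 <= k ->
     (minimal_bicrucial_set k 3
        #= `I_((1 + (k == 3)) * (k + 1) * (k - 2) %/ 2))%card) /\
  ((minimal_bicrucial_set 4 3 #= `I_5)%card /\
   (minimal_bicrucial_set 5 3 #= `I_9)%card /\
   (minimal_bicrucial_set 6 3 #= `I_14)%card /\
   (minimal_bicrucial_set 7 3 #= `I_20)%card /\
   (minimal_bicrucial_set 8 3 #= `I_27)%card /\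
   (minimal_bicrucial_set 9 3 #= `I_35)%card).
Proof.
split; first exact: card_minimal_bicrucial.
by do !split; apply: card_minimal_bicrucial.
Qed.
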